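(* Let $(\mathbf d_n)_{n\ge1}$ be a family of degree sequences, $\mathbf d_n=(d_{n,1},\ldots,d_{n,n})\in\mathbb N_0^n$ with $\sum_{j=1}^n d_{n,j}=n$, and let $(v_n)_{n\ge1}$ be vertices with $v_n\in[n]$. Assume \[\sigma^2(\mathbf d_n)=o(n),\qquad \sigma^2(\mathbf d_n)=\omega(n^{-1}),\qquad \Delta(\mathbf d_n)=o\big(\sqrt{n\sigma^2(\mathbf d_n)}\big)\] as $n\to\infty$. Then $\mathfrak s_n(v_n)/\sqrt{n/\sigma^2(\mathbf d_n)}$ converges in distribution to the standard Rayleigh distribution, i.e. \[\lim_{n\to\infty}\mathbb P\Big(\mathfrak s_n(v_n)>x\sqrt{n/\sigma^2(\mathbf d_n)}\Big)=e^{-x^2/2}\quad\text{for all }x>0.\]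
   Context: A degree sequence is $\mathbf d_n=(d_{n,1},\ldots,d_{n,n})\in\mathbb N_0^n$ with $\sum_j d_{n,j}=n$. For such a sequence let $\mathfrak F(\mathbf d_n)=\{f:[n]\to[n]: |f^{-1}(\{i\})|=d_{n,i}\ \forall i\in[n]\}$; a random functional graph with degree sequence $\mathbf d_n$ is the graph with edges $\{(v,F(v))\}$ where $F$ is uniform on $\mathfrak F(\mathbf d_n)$. For $f:V\to V$ and $v\in V$, the six-length is $\mathfrak s_f(v)=\min\{k\in\mathbb N: f^{(k)}(v)\in\{f^{(j)}(v):0\le j\le k-1\}\}$ ($f^{(k)}$ the $k$-fold composition, $f^{(0)}=\mathrm{id}$); $\mathfrak s_n(v)$ denotes $\mathfrak s_F(v)$ for $F$ uniform on $\mathfrak F(\mathbf d_n)$. Notation: $\Delta(\mathbf d_n)=\max_j d_{n,j}$, $m_k(\mathbf d_n)=\sum_j d_{n,j}^k$, $\sigma^2(\mathbf d_n)=m_2(\mathbf d_n)/n-1$. $a_n=\omega(b_n)$ means $b_n=o(a_n)$. *)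

(* Defs.v *)
From mathcomp Require Import all_boot.
From Stdlib Require Import Reals.
Set Implicit Arguments. Unset Strict Implicit. Unset Printing Implicit Defensive.

Definition fgraphs (n : nat) (d : 'I_n -> nat) : {set {ffun 'I_n -> 'I_n}} :=
  [set f : {ffun 'I_n -> 'I_n} | [forall i : 'I_n, #|[pred j | f j == i]| == d i]].

(* six-length: min{k >= 1 : f^(k)(v) \in {f^(j)(v) : 0 <= j <= k-1}}.
   The search over k-1 in {0,..,#|T|-1} suffices since by pigeonhole
   the minimum is at most #|T|. *)
Definition sixlen (T : finType) (f : T -> T) (v : T) : nat :=
  (find (fun k => iter k.+1 f v \in [seq iter j f v | j <- iota 0 k.+1])
        (iota 0 #|T|)).+1.

Definition m2 (n : nat) (d : 'I_n -> nat) : nat := \sum_(i < n) (d i) ^ 2.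
Definition maxdeg (n : nat) (d : 'I_n -> nat) : nat := \max_(i < n) d i.

Definition sigma2 (n : nat) (d : 'I_n -> nat) : R :=
  (INR (m2 d) / INR n - 1)%R.

Definition prob_six_gt (n : nat) (d : 'I_n -> nat) (v : 'I_n) (t : R) : R :=
  (INR #|[set f in fgraphs d |
            if Rlt_dec t (INR (sixlen f v)) then true else false]|
   / INR #|fgraphs d|)%R.

Definition little_o (a b : nat -> R) : Prop :=
  forall eps : R, (0 < eps)%R ->
    exists N : nat, forall n : nat, (N <= n)%coq_nat ->
      (Rabs (a n) <= eps * Rabs (b n))%R.

(* Main.v *)
(* Exchangeability of the unrevealed sources shows that the orbit of v meets k new
   vertices with probability e_k(d restricted to [n] \ v) / C(n, k), where e_k is the
   elementary symmetric polynomial.  With d = 1 + delta this ratio equals, up to a factor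
   tending to 1, the sum over j of e_j((k/n) delta) times a ratio of falling factorials
   that lies in [0, 1] and tends to 1.  For k ~ x sqrt(n / sigma^2) the power sums of
   (k/n) delta tend to 0, x^2, 0, 0, ..., so by Newton's identities e_j tends to the j-th
   Taylor coefficient of exp(- x^2 z^2 / 2); the same identities dominate e_j by a
   geometric sequence, and dominated convergence gives the limit exp(- x^2 / 2). *)

Require Import Defs.
From Stdlib Require Import Reals.
From mathcomp Require Import all_boot all_algebra perm.
Set Implicit Arguments. Unset Strict Implicit. Unset Printing Implicit Defensive.
Import GRing.Theory.

(** * Elementary symmetric polynomials *)

Section ElementarySymmetric.
Local Open Scope ring_scope.
Variables (R : comNzRingType) (T : finType).
Implicit Types (A S U : {set T}) (y : T -> R) (w : T).

Definition elsym y A j : R :=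
  \sum_(S : {set T} | (S \subset A) && (#|S| == j)) \prod_(i in S) y i.

Lemma elsym0 y A : elsym y A 0 = 1.
Proof.
rewrite /elsym (big_pred1 set0) ?big_set0 // => S /=.
by rewrite cards_eq0; case: eqP => [->|_]; rewrite ?sub0set // andbF.
Qed.

Lemma elsym_scale y a A j : elsym (fun i => a * y i) A j = a ^+ j * elsym y A j.
Proof.
rewrite /elsym big_distrr; apply: eq_bigr => S /andP[_ /eqP <-].
by rewrite big_split /= prodr_const.
Qed.

Lemma elsym_through y A w j : w \in A ->
  \sum_(S : {set T} | [&& S \subset A, #|S| == j.+1 & w \in S])
    \prod_(i in S) y i = y w * elsym y (A :\ w) j.
Proof.
move=> wA; rewrite /elsym big_distrr /=.
rewrite (reindex_onto (fun S => w |: S) (fun S => S :\ w)) /=; last first.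
  by move=> S /and3P[_ _ wS]; rewrite setD1K.
apply: eq_big => S; last first.
  by move=> /andP[_ /eqP <-]; rewrite big_setU1 //= !inE eqxx.
rewrite subUset sub1set wA setU11 andbT /= subsetD1.
case: (boolP (w \in S)) => wS; last first.
  by rewrite cardsU1 wS eqSS andbT setU1K // eqxx andbT.
rewrite andbF andFb; apply/negbTE; rewrite negb_and; apply/orP; right.
by apply: contraTneq wS => <-; rewrite !inE eqxx.
Qed.

Lemma elsymD1 y A w j : w \in A ->
  elsym y A j.+1 = elsym y (A :\ w) j.+1 + y w * elsym y (A :\ w) j.
Proof.
move=> wA; rewrite -elsym_through // {1}/elsym (bigID (fun S => w \in S)) /= addrC.
congr (_ + _); last by apply: eq_bigl => S; rewrite -andbA.
by apply: eq_bigl => S; rewrite subsetD1 andbAC.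
Qed.

(** Double counting: a set [S] of size [j.+1] arises once from each of its elements [w]. *)
Lemma sum_elsymD1 y A j :
  \sum_(w in A) y w * elsym y (A :\ w) j = elsym y A j.+1 *+ j.+1.
Proof.
under eq_bigr => w wA do rewrite -elsym_through //.
rewrite (exchange_big_dep (fun S : {set T} => (S \subset A) && (#|S| == j.+1))) /=; last first.
  by move=> w S _ /and3P[-> ->].
rewrite /elsym -sumrMnl; apply: eq_bigr => S /andP[SA /eqP cS].
rewrite (eq_bigl (mem S)); first by rewrite sumr_const cS.
move=> w; rewrite SA cS eqxx /=; apply: andb_idl; exact: (subsetP SA).
Qed.

(* Unrolling [elsymD1], the terms y_w^(i+1) e_j(A \ w) telescope. *)
Lemma sum_exp_elsymD1 y A r j :
  \sum_(w in A) y w ^+ r.+1 * elsym y (A :\ w) j =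
  \sum_(i < j.+1) (- 1) ^+ i * (\sum_(w in A) y w ^+ (r + i).+1) * elsym y A (j - i)%N.
Proof.
elim: j r => [|j IH] r.
  rewrite big_ord1 /= expr0 mul1r addn0 big_distrl /=.
  by apply: eq_bigr => w _; rewrite !elsym0.
rewrite big_ord_recl /= expr0 mul1r addn0 subn0 big_distrl /=.
transitivity (\sum_(w in A) (y w ^+ r.+1 * elsym y A j.+1
                            - y w ^+ r.+2 * elsym y (A :\ w) j)).
  apply: eq_bigr => w wA.
  by rewrite (elsymD1 y j wA) mulrDr mulrA -exprSr addrK.
rewrite sumrB IH; congr (_ + _).
rewrite -sumrN; apply: eq_bigr => i _ /=.
by rewrite /bump /= !add1n subSS addnS addSn exprS !mulNr mul1r.
Qed.

(** Both sides evaluate the sum of [y w * elsym y (A :\ w) j], the left one by double counting, the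
    right one by telescoping at [r = 0]. *)
Lemma newton_identity y A j :
  elsym y A j.+1 *+ j.+1 =
  \sum_(i < j.+1) (- 1) ^+ i * (\sum_(w in A) y w ^+ i.+1) * elsym y A (j - i)%N.
Proof. by rewrite -sum_elsymD1 -(sum_exp_elsymD1 y A 0). Qed.

Lemma prod_1D y S :
  \prod_(i in S) (1 + y i) = \sum_(U : {set T} | U \subset S) \prod_(i in U) y i.
Proof.
(* Outside [S] the factor is [0 + 1], so the product can run over the whole type; after
   distributing, every [U] not inside [S] has a zero factor. *)
transitivity (\prod_i ((if i \in S then y i else 0) + 1)).
  by rewrite big_mkcond; apply: eq_bigr => i _; case: ifP; rewrite ?add0r // addrC.
rewrite bigA_distr [RHS]big_mkcond; apply: eq_bigr => U _; rewrite -big_mkcond /=.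
case: ifP => [US|/negbT/subsetPn[i iU niS]].
  by apply: eq_bigr => i /(subsetP US) ->.
by rewrite (bigD1 i) //= (negbTE niS) mul0r.
Qed.

(** Such sets are the unions of [U] with a subset of [A :\: U] of size [k - #|U|]. *)
Lemma card_between U A k : U \subset A -> (#|U| <= k)%N ->
  #|[set S : {set T} | [&& U \subset S, S \subset A & #|S| == k]]| =
  'C(#|A| - #|U|, k - #|U|).
Proof.
move=> UA Uk; rewrite -cardsDS // -cards_draws.
rewrite -[RHS](card_in_imset (f := fun S => U :|: S)); last first.
  move=> S S'; rewrite !inE !subsetD => /andP[/andP[_ dS] _] /andP[/andP[_ dS'] _].
  move=> /(congr1 (fun V => V :\: U)); rewrite !setDUl !setDv !set0U.
  by move/setDidPl: dS => ->; move/setDidPl: dS' => ->.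
apply: eq_card => S; rewrite inE; apply/and3P/imsetP => [[US SA /eqP cS]|[V]].
  exists (S :\: U); last by rewrite -[LHS](setID S U) (setIidPr US).
  by rewrite inE setSD // cardsDS // cS /=.
rewrite inE subsetD => /andP[/andP[VA dV] /eqP cV] ->.
rewrite subsetUl subUset UA VA cardsU cV setIC (disjoint_setI0 dV) cards0 subn0.
by rewrite subnKC.
Qed.

(** After each product is expanded over the subsets [U] of [S], the term of [U] occurs once for
    every [S] of size [k] between [U] and [A]. With [y] the degrees minus 1, this is an expansion
    around the constant degree sequence 1. *)
Lemma elsym_1D y A k :
  elsym (fun i => 1 + y i) A k =
  \sum_(j < k.+1) elsym y A j *+ 'C(#|A| - j, k - j)%N.
Proof.
rewrite /elsym; under eq_bigr do rewrite prod_1D.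
rewrite (exchange_big_dep (fun U : {set T} => (U \subset A) && (#|U| < k.+1)%N)) /=; last first.
  move=> S U /andP[SA /eqP <-] US; rewrite (subset_trans US SA) ltnS.
  exact: subset_leq_card.
transitivity (\sum_(U : {set T} | (U \subset A) && (#|U| < k.+1)%N)
   (\prod_(i in U) y i) *+ 'C(#|A| - #|U|, k - #|U|)).
  apply: eq_bigr => U /andP[UA Uk]; rewrite -card_between // -sumr_const.
  by apply: eq_bigl => S; rewrite !inE [RHS]andbC -andbA andbC -andbA.
under [RHS]eq_bigr => j _ do rewrite -sumrMnl.
rewrite (exchange_big_dep (fun U : {set T} => (U \subset A) && (#|U| < k.+1)%N)) /=; last first.
  by move=> j U _ /andP[-> /eqP ->]; rewrite ltn_ord.
apply: eq_bigr => U /andP[UA Uk]; rewrite (big_pred1 (Ordinal Uk)) // => j.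
by rewrite UA /= [LHS]eq_sym.
Qed.
End ElementarySymmetric.

(** * Counting functions whose orbit does not repeat *)

Section FreshOrbit.
Variable T : finType.
Implicit Types (f : T -> T) (u : T) (p : seq T).

(** Recursive counterpart of the test in [sixlen]; the vertices visited earlier are carried along in
    [p], so that an induction can move the starting point. *)
Fixpoint fresh f k u p : bool :=
  if k is k'.+1 then (f u \notin u :: p) && fresh f k' (f u) (u :: p) else true.

Lemma freshP f k u p :
  reflect (forall i, i < k ->
            iter i.+1 f u \notin p ++ [seq iter j f u | j <- iota 0 i.+1])
          (fresh f k u p).
Proof.
(* Starting one step later moves [v] from the orbit segment to the list of earlier vertices. *)
have shift i v q : iter i.+1 f (f v) \notin
      (v :: q) ++ [seq iter j f (f v) | j <- iota 0 i.+1] =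
    (iter i.+2 f v \notin q ++ [seq iter j f v | j <- iota 0 i.+2]).
  have -> : iota 0 i.+2 = 0 :: [seq 1 + j | j <- iota 0 i.+1].
    by rewrite -(iotaDl 1 0).
  have -> : [seq iter j f (f v) | j <- iota 0 i.+1] =
      [seq iter j f v | j <- [seq 1 + j | j <- iota 0 i.+1]].
    by rewrite -map_comp; apply: eq_map => j /=; rewrite -iterSr.
  rewrite -iterSr map_cons !(mem_cat, inE).
  by rewrite -orbA orbCA.
elim: k u p => [|k IH] u p /=; first by constructor.
apply: (iffP andP) => [[fu /IH fr] [|i] ik|H].
- by rewrite /= mem_cat inE orbC.
- by rewrite -shift; apply: fr.
split; first by move: (H 0 isT); rewrite /= mem_cat inE orbC.
by apply/IH => i ik; rewrite shift; apply: (H i.+1 ik).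
Qed.

(** The bound on [k] keeps every tested index inside the range searched by [sixlen]. *)
Lemma ltn_sixlen f k v : k <= #|T| -> (k < sixlen f v) = fresh f k v [::].
Proof.
move=> kn; rewrite /sixlen ltnS; set a := (fun k => _).
apply/idP/freshP => [kf i ik|H].
  have := before_find 0 (leq_trans ik kf).
  by rewrite nth_iota ?(leq_trans ik) // add0n /a => /negbT.
rewrite leqNgt; apply/negP => fk.
have hs : has a (iota 0 #|T|) by rewrite has_find size_iota (leq_trans fk).
have := nth_find 0 hs; rewrite nth_iota ?(leq_trans fk) // add0n /a.
by apply/negP; apply: H.
Qed.
End FreshOrbit.

(** * Walk counts from exchangeability of the sources *)

Section Counting.
Variables (n : nat) (d : 'I_n -> nat).
Implicit Types (u v w r : 'I_n) (p : seq 'I_n).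

(* Orbits are recorded backwards: [u :: p] lists the visited vertices, last one first. *)
Definition walks u p : {set {ffun 'I_n -> 'I_n}} :=
  [set f in fgraphs d | path (fun a b => f b == a) u p].

Definition fresh_walks j u p := [set f in walks u p | fresh f j u p].

(** Consequently a vertex outside [u :: p] has all its preimages outside [p], which is how
    [card_walks_cons] obtains the full factor [d w]. *)
Lemma path_image (f : 'I_n -> 'I_n) u p r :
  path (fun a b => f b == a) u p -> r \in p -> f r \in u :: p.
Proof.
elim: p u => // b p IH u /= /andP[/eqP fb pp]; rewrite inE => /orP[/eqP ->|rp].
  by rewrite fb mem_head.
by rewrite inE (IH b) // orbT.
Qed.

Definition swap u r (f : {ffun 'I_n -> 'I_n}) : {ffun 'I_n -> 'I_n} :=
  [ffun x => f (tperm u r x)].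

Lemma swapK u r : involutive (swap u r).
Proof. by move=> f; apply/ffunP => x; rewrite !ffunE tpermK. Qed.

Lemma eq_walk (f g : 'I_n -> 'I_n) u p : {in p, f =1 g} ->
  path (fun a b => f b == a) u p = path (fun a b => g b == a) u p.
Proof.
elim: p u => //= b p IH u fg; rewrite fg ?mem_head //; congr andb.
by apply: IH => x xp; apply: fg; rewrite inE xp orbT.
Qed.

(** Precomposition with a transposition keeps all fibre sizes, and the recorded walk is untouched
    because neither [u] nor [r] lies in [p]. *)
Lemma swap_walks u p r f : uniq (u :: p) -> r \notin p ->
  f \in walks u p -> swap u r f \in walks u p.
Proof.
move=> /= /andP[up _] rp; rewrite !inE => /andP[/forallP fd fp]; apply/andP; split.
  apply/forallP => i; apply/eqP; rewrite -[RHS](eqP (fd i)) -!sum1_card.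
  rewrite [RHS](reindex_inj (@perm_inj _ (tperm u r))) /=.
  by apply: eq_bigl => x; rewrite !inE ffunE.
rewrite -(eq_walk (f := f)) // => b bp; rewrite ffunE tpermD //.
  by apply: contraNneq up => ->.
by apply: contraNneq rp => ->.
Qed.

(* The [n - size p] sources outside [p] are exchangeable, and [d w] of them map to [w]. *)
Lemma card_walks_cons u p w : uniq (u :: p) -> w \notin u :: p ->
  (n - size p) * #|walks w (u :: p)| = d w * #|walks u p|.
Proof.
move=> uup wup.
have up : uniq p by case/andP: uup.
(* [swap u r] exchanges the maps sending [r] to [w] with those sending [u] to [w], so the count does
   not depend on [r]. *)
have E r : r \notin p ->
    #|[set f in walks u p | f r == w]| = #|walks w (u :: p)|.
  move=> rp; rewrite -(card_imset _ (can_inj (swapK u r))).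
  apply: eq_card => f; apply/imsetP/idP => [[g]|].
    rewrite inE => /andP[gw /eqP gr] ->.
    have := swap_walks uup rp gw; rewrite !inE /= => /andP[-> ->].
    by rewrite ffunE tpermL gr eqxx.
  move=> fw; exists (swap u r f); last by rewrite swapK.
  move: fw; rewrite inE /= => /and3P[fd fu fp].
  have fw : f \in walks u p by rewrite inE fd.
  by rewrite inE swap_walks //= ffunE tpermR.
(* The pairs of a source [r] outside [p] and a walk [f] with [f r = w] are now counted in both
   orders. *)
transitivity (\sum_(r | r \notin p) #|[set f in walks u p | f r == w]|).
  under eq_bigr => r rp do rewrite E //.
  rewrite sum_nat_const; congr (_ * _).
  have := cardC (mem p); rewrite card_ord (card_uniqP up) => {1}<-.
  by rewrite addKn.
transitivity (\sum_(r | r \notin p) \sum_(f in walks u p | f r == w) 1).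
  by apply: eq_bigr => r _; rewrite sum1dep_card.
rewrite (exchange_big_dep (mem (walks u p))) /=; last by move=> r f _ /andP[].
rewrite mulnC -sum_nat_const; apply: eq_bigr => f fw.
rewrite sum1dep_card -[RHS]/(d w).
move: fw; rewrite !inE => fw; have /andP[/forallP fd fp] := fw; rewrite -(eqP (fd w)) -cardsE.
apply: eq_card => r; rewrite !inE; rewrite fw /=; apply: andb_idl => /eqP frw.
by apply: contra wup => rp; rewrite -frw; apply: path_image fp rp.
Qed.

Section Ring.
Local Open Scope ring_scope.
Variable R : comNzRingType.

(** Induction on [j], splitting by the next vertex [w]: each [w] contributes [d w / (n - size p)] by
    [card_walks_cons], and [sum_elsymD1] collects these contributions into the next elementary
    symmetric polynomial. Denominators are cleared, so any commutative ring will do. *)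
Lemma card_fresh_walks j u p : uniq (u :: p) ->
  (#|fresh_walks j u p| * (n - size p) ^_ j)%:R =
  #|walks u p|%:R * elsym (fun i => (d i)%:R) (~: [set:: u :: p]) j *+ j`! :> R.
Proof.
elim: j u p => [|j IH] u p uup.
  rewrite elsym0 mulr1 fact0 mulr1n ffactn0 muln1; congr (_%:R).
  by apply: eq_card => f; rewrite [LHS]inE andbT.
have split_f : #|fresh_walks j.+1 u p| =
    (\sum_(w | w \notin u :: p) #|fresh_walks j w (u :: p)|)%N.
  rewrite -sum1_card (partition_big (fun f : {ffun _} => f u) [pred w | w \notin u :: p]) /=.
    apply: eq_bigr => w wup; rewrite -sum1_card; apply: eq_bigl => f.
    rewrite !inE /=; case: (altP (f u =P w)) => [->|_]; last by rewrite !andbF.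
    by rewrite wup /= andbT.
  by move=> f; rewrite inE /= => /andP[_ /andP[]].
rewrite split_f big_distrl natr_sum /= ffactnS.
transitivity (\sum_(w in ~: [set:: u :: p]) #|walks u p|%:R *
   ((d w)%:R * elsym (fun i => (d i)%:R) (~: [set:: u :: p] :\ w) j) *+ j`! :> R).
  apply: eq_big => w; first by rewrite !inE.
  move=> wup; rewrite mulnCA natrM -subnS IH; last by rewrite /= -/(uniq (u :: p)) wup.
  rewrite -mulrnAr mulrA -natrM card_walks_cons // mulnC natrM -!mulrA -mulrnAr.
  rewrite -?mulrnAr; congr (_ * (_ * (elsym _ _ _ *+ _))).
  by apply/setP => x; rewrite !inE negb_or.
by rewrite sumrMnl -big_distrr /= sum_elsymD1 mulrnAr -mulrnA factS.
Qed.
End Ring.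

Lemma fgraphs_neq0 : \sum_(i < n) d i = n -> 0 < #|fgraphs d|.
Proof.
move=> hs.
have [n0|n_gt0] := posnP n.
  apply/card_gt0P; exists [ffun i => i]; rewrite inE; apply/forallP => i.
  by have := ltn_ord i; rewrite [X in _ < X]n0.
(* Each [i] is repeated [d i] times, so the list has length [n], and reading it off by position
   defines a map with the required fibres. *)
pose s := flatten [seq nseq (d i) i | i <- enum 'I_n].
have ss : size s = n.
  rewrite size_flatten /shape -map_comp sumnE big_map -[RHS]hs big_enum /=.
  by apply: eq_bigr => i _; rewrite size_nseq.
pose x0 := Ordinal n_gt0.
apply/card_gt0P; exists [ffun j : 'I_n => nth x0 s j]; rewrite inE; apply/forallP => i.
apply/eqP; transitivity (count_mem i s).
  rewrite -[in RHS](mkseq_nth x0 s) ss /mkseq -val_enum_ord -map_comp count_map.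
  rewrite enumT cardE /enum_mem size_filter.
  by apply: eq_count => j; rewrite /= !inE ffunE.
rewrite count_flatten -map_comp sumnE big_map big_enum /=.
rewrite (bigD1 i) //= count_nseq /= eqxx mul1n big1 ?addn0 // => j ji.
by rewrite count_nseq /= (negbTE ji).
Qed.
End Counting.

(** * Limits of sequences related by Newton's identities *)

From mathcomp Require Import all_order all_classical all_reals all_analysis.
From mathcomp Require Import Rstruct Rstruct_topology ring lra.
Import Order.TTheory Num.Theory numFieldNormedType.Exports.

Section NewtonLimit.
Local Open Scope classical_set_scope.
Local Open Scope ring_scope.
Variable R : realType.

Lemma cvgM_to (u v : nat -> R) (a b c : R) : u @ \oo --> a -> v @ \oo --> b ->
  a * b = c -> (u n * v n) @[n --> \oo] --> c.
Proof. by move=> ua vb <-; apply: cvgM. Qed.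

Lemma cvgD_to (u v : nat -> R) (a b c : R) : u @ \oo --> a -> v @ \oo --> b ->
  a + b = c -> (u n + v n) @[n --> \oo] --> c.
Proof. by move=> ua vb <-; apply: cvgD. Qed.

Lemma cvgB_to (u v : nat -> R) (a b c : R) : u @ \oo --> a -> v @ \oo --> b ->
  a - b = c -> (u n - v n) @[n --> \oo] --> c.
Proof. by move=> ua vb <-; apply: cvgB. Qed.

Lemma cvg_dist_lt (u : nat -> R) (l : R) : u @ \oo --> l ->
  forall eps : R, 0 < eps -> exists N : nat, forall n, (N <= n)%N -> `|l - u n| < eps.
Proof. by move=> /cvgrPdist_lt ul eps /ul[N _ hN]; exists N. Qed.

Lemma sum_halves_le a b : \sum_(a <= i < b) 2^-1 ^+ i <= 2 * 2^-1 ^+ a :> R.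
Proof.
have [ba|/ltnW ab] := leqP b a.
  by rewrite big_geq // mulr_ge0 // exprn_ge0 // invr_ge0.
suff -> : \sum_(a <= i < b) 2^-1 ^+ i = 2 * 2^-1 ^+ a - 2 * 2^-1 ^+ b :> R.
  by rewrite gerBl mulr_ge0 // exprn_ge0 // invr_ge0.
rewrite -(subnKC ab); elim: (b - a)%N => [|k IH]; first by rewrite addn0 big_geq // subrr.
by rewrite addnS big_nat_recr ?leq_addr //= IH exprS; field.
Qed.

(* [p i] plays the role of the power sum of exponent [i.+1]. *)
Definition newton_rec (e p : nat -> R) :=
  e 0 = 1 /\ forall j,
    e j.+1 *+ j.+1 = \sum_(i < j.+1) (- 1) ^+ i * p i * e (j - i)%N.

Lemma newton_recS e p j : newton_rec e p ->
  e j.+1 = j.+1%:R^-1 * \sum_(i < j.+1) (- 1) ^+ i * p i * e (j - i)%N.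
Proof. by move=> [_ <-]; rewrite -[X in _ = _ * X]mulr_natl mulKf // pnatr_eq0. Qed.

(* The recursion multiplies the constant by at most max(1, m / j.+1) at step j, hence it
   stops growing at step m. *)
Lemma newton_bound e p X m : newton_rec e p ->
  (forall i, `|p i| <= X / 4 ^+ i) -> 4 * X <= m%:R ->
  forall j, `|e j| <= m%:R ^+ minn j m * 2^-1 ^+ j.
Proof.
move=> ne hp hm; elim/ltn_ind => -[|j] IH.
  by rewrite (proj1 ne) normr1 min0n !expr0 mulr1.
have X0 : 0 <= X by have := hp 0; rewrite expr0 divr1; apply: le_trans.
have m0 : 0 <= m%:R :> R by [].
have M0 k : 0 <= m%:R ^+ k :> R by rewrite exprn_ge0.
have h0 k : 0 <= 2^-1 ^+ k :> R by rewrite exprn_ge0 // invr_ge0.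
rewrite (newton_recS _ ne) normrM ger0_norm ?invr_ge0 // mulrC ler_pdivrMr ?ltr0n //.
have Mle a b : (a <= b)%N -> m%:R ^+ minn a m <= m%:R ^+ minn b m :> R.
  move=> ab; case: (posnP m) => [->|m_gt0]; first by rewrite !minn0.
  by rewrite ler_weXn2l ?ler1n // leq_min geq_minr geq_min ab.
have step : `|\sum_(i < j.+1) (-1) ^+ i * p i * e (j - i)%N| <=
    4 * X * (m%:R ^+ minn j m * 2^-1 ^+ j.+1).
  apply: le_trans (ler_norm_sum _ _ _) _.
  apply: (@le_trans _ _ (\sum_(i < j.+1) X * (m%:R ^+ minn j m * 2^-1 ^+ j) * 2^-1 ^+ i)).
    apply: ler_sum => i _.
    have ij : (i <= j)%N by rewrite -ltnS.
    rewrite !normrM normrX normrN1 expr1n mul1r.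
    apply: le_trans (ler_pM _ _ (hp i) (IH (j - i)%N _)) _ => //.
      by rewrite ltnS leq_subr.
    (* One of the two halving factors completes the bound on [e (j - i)] to [2^-1 ^+ j]; the other
       makes the sum over [i] geometric. *)
    have -> : 4 ^+ i = 2 ^+ i * 2 ^+ i :> R by rewrite -exprMn -natrM.
    have -> : 2^-1 ^+ j = 2^-1 ^+ (j - i) * 2^-1 ^+ i :> R by rewrite -exprD subnK.
    rewrite invfM -!exprVn -!mulrA ler_wpM2l //.
    have := Mle _ _ (leq_subr i j).
    move/(ler_wpM2r (mulr_ge0 (h0 (j - i)%N) (mulr_ge0 (h0 i) (h0 i)))).
    by apply: le_trans; rewrite le_eqVlt; apply/orP; left; apply/eqP; ring.
  rewrite -mulr_sumr -(big_mkord xpredT (fun i => 2^-1 ^+ i)).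
  apply: le_trans (ler_wpM2l _ (sum_halves_le _ _)) _.
    by rewrite !mulr_ge0.
  by rewrite expr0 exprS; lra.
apply: le_trans step _; rewrite [leRHS]mulrC [leRHS]mulrA.
rewrite mulrA ler_wpM2r //.
have [jm|mj] := ltnP j m.
  rewrite (minn_idPl jm) exprS mulrA ler_wpM2r //.
  by apply: le_trans hm _; rewrite ler_peMl // ler1n.
rewrite (minn_idPr (leqW mj)) ler_wpM2r //.
by apply: le_trans hm _; rewrite ler_nat leqW.
Qed.

(** Strong induction: the recursion writes [e n j.+1] as a polynomial, independent of [n], in
    finitely many [p n i] and earlier terms. *)
Lemma newton_cvg (e p : nat -> nat -> R) (P c : nat -> R) :
  (forall n, newton_rec (e n) (p n)) -> newton_rec c P ->
  (forall i, p n i @[n --> \oo] --> P i) ->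
  forall j, e n j @[n --> \oo] --> c j.
Proof.
move=> ne nc hp; elim/ltn_ind => -[|j] IH.
  rewrite (proj1 nc); apply: cvg_near_cst.
  by near=> n; rewrite (proj1 (ne n)).
rewrite (newton_recS _ nc).
rewrite (_ : (fun n => e n j.+1) = (fun n => j.+1%:R^-1 *
    \sum_(i < j.+1) (- 1) ^+ i * p n i * e n (j - i)%N)); last first.
  by apply/funext => n; rewrite (newton_recS _ (ne n)).
apply: cvgM; first exact: cvg_cst.
apply: cvg_big => [|i _]; first exact: add_continuous.
apply: cvgM; last by apply: IH; rewrite ltnS leq_subr.
by apply: cvgM; [exact: cvg_cst|exact: hp].
Unshelve. all: by end_near. Qed.

(** Tannery's theorem, that is, dominated convergence for sums of growing length. The sum is cut at
    a fixed [J] past which the geometric majorant is small; the head then converges term by term. *)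
Lemma tannery (f : nat -> nat -> R) (c : nat -> R) (k : nat -> nat) (M l : R) :
  (forall j, f n j @[n --> \oo] --> c j) ->
  (\forall n \near \oo, forall j, `|f n j| <= M * 2^-1 ^+ j) ->
  k n @[n --> \oo] --> \oo ->
  (\sum_(0 <= j < J) c j) @[J --> \oo] --> l ->
  (\sum_(0 <= j < k n) f n j) @[n --> \oo] --> l.
Proof.
move=> fc fM koo cl; apply/cvgrPdist_le => eps eps0.
have tail : (M * (2 * 2^-1 ^+ J)) @[J --> \oo] --> (0 : R).
  rewrite -(mulr0 M); apply: cvgM; first exact: cvg_cst.
  rewrite -(mulr0 2); apply: cvgM; first exact: cvg_cst.
  by apply: (@cvg_expr R); rewrite ger0_norm ?invr_ge0 // invf_lt1 // ltr1n.
have e3 : 0 < eps / 3 by rewrite divr_gt0.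
have [J [tJ cJ]] : exists J, M * (2 * 2^-1 ^+ J) <= eps / 3 /\
    `|l - \sum_(0 <= j < J) c j| <= eps / 3.
  have A : \forall J \near \oo, M * (2 * 2^-1 ^+ J) <= eps / 3 /\
      `|l - \sum_(0 <= j < J) c j| <= eps / 3.
    near=> J; split; last by near: J; move/cvgrPdist_le: cl; apply.
    have : `|0 - M * (2 * 2^-1 ^+ J)| <= eps / 3.
      by near: J; move/cvgrPdist_le: tail; apply.
    by rewrite sub0r normrN; apply: le_trans; rewrite ler_norm.
  by have [J] := filter_ex A; exists J.
have head : (\sum_(0 <= j < J) f n j) @[n --> \oo] --> \sum_(0 <= j < J) c j.
  by apply: cvg_big => // ; exact: add_continuous.
near=> n.
have Jk : (J <= k n)%N by near: n; move/cvgnyPge: koo; apply.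
have fMn j : `|f n j| <= M * 2^-1 ^+ j by move: j; near: n.
have hn : `|\sum_(0 <= j < J) c j - \sum_(0 <= j < J) f n j| <= eps / 3.
  by near: n; move/cvgrPdist_le: head; apply.
have tn : `|\sum_(J <= j < k n) f n j| <= eps / 3.
  apply: le_trans (ler_norm_sum _ _ _) _.
  apply: le_trans (ler_sum _ (fun j _ => fMn j)) _.
  rewrite -mulr_sumr; apply: le_trans tJ; apply: ler_wpM2l (sum_halves_le _ _).
  by have := fMn 0; rewrite expr0 mulr1; apply: le_trans.
rewrite (@big_cat_nat _ _ _ J) //=.
set s1 := \sum_(0 <= j < J) f n j in hn *; set s2 := \sum_(J <= j < k n) _ in tn *.
set s3 := \sum_(0 <= j < J) c j in hn cJ.
have -> : l - (s1 + s2) = (l - s3) + (s3 - s1) - s2 by ring.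
apply: le_trans (ler_normB _ _) _; have := ler_normD (l - s3) (s3 - s1); lra.
Unshelve. all: by end_near. Qed.

(** The coefficient of z^j in exp(- x^2 z^2 / 2). *)
Definition gauss_coef (x : R) j : R :=
  if odd j then 0 else exp_coeff (- x ^+ 2 / 2) j./2.

(** Only the power sum of exponent 2 is nonzero, so the recursion reads (j + 2) c_(j+2) = - x^2 c_j,
    which is the differential equation g' = - x^2 z g. *)
Lemma gauss_coef_newton x :
  newton_rec (gauss_coef x) (fun i => if i == 1 then x ^+ 2 else 0).
Proof.
split=> [|[|j]]; first by rewrite /gauss_coef /exp_coeff /= expr0 fact0 divr1.
  by rewrite big_ord1 /= expr0 mulr0 mul0r.
rewrite (bigD1 (Ordinal (isT : (1 < j.+2)%N))) //= big1 ?addr0; last first.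
  by move=> i /eqP i1; case: eqP => [E|_]; [case: i1; apply: val_inj|rewrite mulr0 mul0r].
rewrite expr1 subn1 /= /gauss_coef /= negbK; case: ifP => [_|jo].
  by rewrite mul0rn mulr0.
have -> : j.+2 = j./2.+1.*2 by rewrite doubleS -[in LHS](odd_double_half j) jo.
rewrite -muln2 mulrnA /exp_coeff /= exprS factS natrM.
have f0 : j./2`!%:R != 0 :> R by rewrite pnatr_eq0 -lt0n fact_gt0.
rewrite -[X in X *+ 2]mulr_natr; set y := x ^+ 2; set z := _ ^+ j./2.
by field; rewrite f0 nat1r pnatr_eq0.
Qed.

(** Odd terms vanish, so the first [J] terms are the first [uphalf J] terms of the exponential
    series. *)
Lemma sum_gauss_coef x :
  (\sum_(0 <= j < J) gauss_coef x j) @[J --> \oo] --> expR (- x ^+ 2 / 2).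
Proof.
have E J : \sum_(0 <= j < J) gauss_coef x j =
    series (exp_coeff (- x ^+ 2 / 2)) (uphalf J).
  elim: J => [|J IH]; first by rewrite big_geq // /series /= big_geq.
  rewrite big_nat_recr //= IH /gauss_coef uphalf_half /series /=.
  case: ifP => oJ; first by rewrite addr0.
  by rewrite add0n big_nat_recr.
under eq_fun do rewrite E.
apply: (cvg_comp uphalf); last exact: is_cvg_series_exp_coeff.
apply/cvgnyPge => A; near=> J.
have AJ : (A.*2 <= J)%N by near: J; exact: nbhs_infty_ge.
rewrite uphalf_half -[A in (A <= _)%N](doubleK A).
by apply: leq_trans (half_leq AJ) (leq_addl _ _).
Unshelve. all: by end_near. Qed.

(** For [j <= k <= n], [k ^_ j / n ^_ j] is the probability that a uniform [k]-subset of an [n]-set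
    contains [j] given points; it is compared here with the value (k/n)^j for independent
    inclusions. *)
Definition ffact_ratio k n j : R :=
  (k ^_ j)%:R / (n ^_ j)%:R / (k%:R / n%:R) ^+ j.

Lemma ffact_ratioS k n j : ffact_ratio k n j.+1 =
  ffact_ratio k n j * ((k - j)%:R / (n - j)%:R * (n%:R / k%:R)).
Proof.
by rewrite /ffact_ratio !ffactnSr !natrM exprSr !invfM !invrK; ring.
Qed.

Lemma ffact_factor_le1 k n j : (0 < k <= n)%N ->
  0 <= ((k - j)%:R / (n - j)%:R * (n%:R / k%:R) : R) <= 1.
Proof.
move=> /andP[k0 kn]; rewrite !mulr_ge0 ?invr_ge0 //= mulrACA -invfM -!natrM.
(* For [n <= j] the truncated difference [n - j] is 0, and so is its inverse by convention. *)
have [nj|jn] := leqP n j.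
  by move: nj; rewrite -subn_eq0 => /eqP ->; rewrite mul0n invr0 mulr0.
rewrite ler_pdivrMr ?mul1r ?ltr0n ?muln_gt0 ?subn_gt0 ?jn //.
rewrite ler_nat !mulnBl (mulnC n k) leq_sub2l // leq_mul2l kn orbT //.
Qed.

Lemma ffact_factor_ge k n j : (j < k <= n)%N ->
  1 - j%:R / k%:R <= (k - j)%:R / (n - j)%:R * (n%:R / k%:R) :> R.
Proof.
move=> /andP[jk kn]; have k0 : 0 < k%:R :> R by rewrite ltr0n (leq_ltn_trans _ jk).
have jn : (j < n)%N by apply: leq_trans kn.
have -> : 1 - j%:R / k%:R = (k - j)%:R / k%:R :> R.
  by rewrite natrB ?(ltnW jk) // mulrBl divff // gt_eqF.
rewrite mulrA ler_pM2r ?invr_gt0 // mulrAC -mulrA ler_peMr //.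
by rewrite ler_pdivlMr ?mul1r ?ler_nat ?leq_subr // ltr0n subn_gt0.
Qed.

Lemma ffact_ratio_itv k n j : (0 < k <= n)%N -> 0 <= ffact_ratio k n j <= 1.
Proof.
move=> kn; elim: j => [|j /andP[IH0 IH1]].
  by rewrite /ffact_ratio !ffactn0 expr0 !divr1 ler01 lexx.
rewrite ffact_ratioS; have /andP[f0 f1] := ffact_factor_le1 j kn.
by rewrite mulr_ge0 //= mulr_ile1.
Qed.

Lemma ffact_ratio_cvg (k : nat -> nat) j : k n @[n --> \oo] --> \oo ->
  (\forall n \near \oo, k n <= n)%N ->
  ffact_ratio (k n) n j @[n --> \oo] --> (1 : R).
Proof.
move=> koo kn; elim: j => [|j IH].
  by apply: cvg_near_cst; near=> n; rewrite /ffact_ratio !ffactn0 expr0 !divr1.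
under eq_fun do rewrite ffact_ratioS.
suff F : ((k n - j)%:R / (n - j)%:R * (n%:R / (k n)%:R)) @[n --> \oo] --> (1 : R).
  exact: cvgM_to IH F (mulr1 1).
(* For fixed [j] the new factor lies between [1 - j / k n] and 1. *)
apply: (@squeeze_cvgr _ _ _ _ (fun n => 1 - j%:R / (k n)%:R) (fun=> 1)).
- near=> n; apply/andP; split.
    apply: ffact_factor_ge; apply/andP; split; near: n => //.
    by move/cvgnyPgt : koo; apply.
  have /ffact_factor_le1 : (0 < k n <= n)%N.
    apply/andP; split; near: n => //; by move/cvgnyPgt : koo; apply.
  by move=> /(_ j) /andP[].
- suff V : ((k n)%:R^-1 : R) @[n --> \oo] --> (0 : R).
    apply: (cvgB_to _ _ (subr0 1)); first exact: cvg_cst.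
    by apply: (cvgM_to _ V (mulr0 j%:R)); exact: cvg_cst.
  apply/gtr0_cvgV0; last by apply/cvgrnyP.
  by near=> n; rewrite ltr0n; near: n; move/cvgnyPgt : koo; apply.
- exact: cvg_cst.
Unshelve. all: by end_near. Qed.

Lemma newton_sum_cvg (e p : nat -> nat -> R) (k : nat -> nat) (x X : R) :
  (forall n, newton_rec (e n) (p n)) ->
  (forall i, p n i @[n --> \oo] --> (if i == 1 then x ^+ 2 else 0)) ->
  (\forall n \near \oo, forall i, `|p n i| <= X / 4 ^+ i) ->
  k n @[n --> \oo] --> \oo -> (\forall n \near \oo, k n <= n)%N ->
  (\sum_(0 <= j < (k n).+1) e n j * ffact_ratio (k n) n j) @[n --> \oo] -->
    expR (- x ^+ 2 / 2).
Proof.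
move=> ne pc pb koo kn.
(* An integer above [4 * X], as [newton_bound] requires; its power [m ^ m] then bounds
   [m ^ minn j m] for all [j]. *)
pose m := (Num.truncn (4 * X)).+1.
apply: (@tannery _ (gauss_coef x) (fun n => (k n).+1) (m%:R ^+ m)).
- move=> j; rewrite -(mulr1 (gauss_coef x j)); apply: cvgM.
    exact: newton_cvg ne (gauss_coef_newton x) pc j.
  exact: ffact_ratio_cvg.
- near=> n => j; have kn' : (0 < k n <= n)%N.
    apply/andP; split; near: n => //; by move/cvgnyPgt : koo; apply.
  have /andP[r0 r1] := ffact_ratio_itv j kn'.
  rewrite normrM (ger0_norm r0); apply: le_trans (ler_piMr _ r1) _ => //.
  have pbn : forall i, `|p n i| <= X / 4 ^+ i by near: n.
  have hm : 4 * X <= m%:R by rewrite ltW // truncnS_gt.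
  apply: le_trans (newton_bound (ne n) pbn hm j) _.
  rewrite ler_wpM2r ?exprn_ge0 ?invr_ge0 // ler_weXn2l ?ler1n //.
  exact: geq_minr.
- apply/cvgnyPge => A; near=> n; apply: leqW; near: n.
  by move/cvgnyPge : koo; apply.
- exact: sum_gauss_coef.
Unshelve. all: by end_near. Qed.
End NewtonLimit.

(** * Limit of e_k(1 + delta) / C(n, k) for centred delta *)

Lemma bin_ffact_sub n k j : j <= k <= n ->
  'C(n - j, k - j) * n ^_ j = 'C(n, k) * k ^_ j.
Proof.
elim: j => [|j IH] /andP[jk kn]; first by rewrite !subn0 !ffactn0.
have E : (n - j) * 'C(n - j.+1, k - j.+1) = (k - j) * 'C(n - j, k - j).
  by rewrite !subnS mul_bin_diag prednK // subn_gt0.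
rewrite !ffactnSr mulnA mulnC mulnA E -mulnA IH ?(ltnW jk) // mulnC.
by rewrite -mulnA.
Qed.

Section Elsym.
Local Open Scope classical_set_scope.
Local Open Scope ring_scope.
Variable R : realType.

Lemma newton_rec_elsym (T : finType) (y : T -> R) (A : {set T}) :
  newton_rec (elsym y A) (fun i => \sum_(w in A) y w ^+ i.+1).
Proof. by split=> [|j]; [exact: elsym0|exact: newton_identity]. Qed.

(** The prefactor is ['C(n, k) / 'C(n.+1, k)], the cost of leaving out [v]. The remaining weights
    ['C(n - j, k - j) / 'C(n, k)] split into [(k / n) ^ j], absorbed into the variables, and
    [ffact_ratio]. *)
Lemma elsym_1D_ratio n (v : 'I_n.+1) (y : 'I_n.+1 -> R) k : (0 < k <= n)%N ->
  elsym (fun i => 1 + y i) [set~ v]%SET k / 'C(n.+1, k)%:R =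
  (1 - k%:R / n.+1%:R) *
  \sum_(0 <= j < k.+1) elsym (fun i => k%:R / n%:R * y i) [set~ v]%SET j * ffact_ratio R k n j.
Proof.
move=> /andP[k0 kn].
have n0 : (0 < n)%N by apply: leq_trans kn.
have card_v : #|[set~ v]%SET| = n by rewrite cardsC1 card_ord.
have nat_neq0 m : (0 < m)%N -> m%:R != 0 :> R by rewrite pnatr_eq0 lt0n.
rewrite elsym_1D big_mkord mulr_suml mulr_sumr; apply: eq_bigr => j _.
have jk : (j <= k)%N by rewrite -ltnS.
rewrite card_v elsym_scale /ffact_ratio.
have C1 : 'C(n.+1, k)%:R != 0 :> R by rewrite nat_neq0 // bin_gt0 leqW.
have N0 : (n ^_ j)%:R != 0 :> R by rewrite nat_neq0 // ffact_gt0 (leq_trans jk).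
have T0 : (k%:R / n%:R) ^+ j != 0 :> R by rewrite expf_neq0 // mulf_neq0 ?invr_eq0 ?nat_neq0.
have S0 : n.+1%:R != 0 :> R by rewrite nat_neq0.
have -> : 1 - k%:R / n.+1%:R = 'C(n, k)%:R / 'C(n.+1, k)%:R :> R.
  rewrite -[X in X - _](divff S0) -mulrBl -natrB ?leqW //.
  by apply/eqP; rewrite eqr_div // -!natrM -(mul_bin_down n.+1 k) mulnC.
have : ('C(n - j, k - j) * n ^_ j)%:R = ('C(n, k) * k ^_ j)%:R :> R.
  by rewrite bin_ffact_sub // jk.
rewrite !natrM => /(canRL (mulfK N0)) Eb.
rewrite -[_ *+ 'C(n - j, _)]mulr_natr Eb; set t := (_ / _) ^+ j in T0 *.
by field; rewrite T0 N0 C1.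
Qed.

Section Sequences.
Variables (delta : forall n, 'I_n.+1 -> R) (v : forall n, 'I_n.+1).
Variables (tau D : nat -> R) (x : R).
Let S n := tau n ^+ 2 * \sum_i @delta n i ^+ 2.
Let p n i := \sum_(w in [set~ v n]%SET) (tau n * @delta n w) ^+ i.+1.
Hypothesis tau0 : forall n, 0 <= tau n.
Hypothesis sum_delta : forall n, \sum_i @delta n i = 0.
Hypothesis delta_le : forall n i, `|@delta n i| <= D n.
Hypothesis tauD : (tau n * D n) @[n --> \oo] --> (0 : R).
Hypothesis S_cvg : S @ \oo --> x ^+ 2.

Let y_le n i : `|tau n * @delta n i| <= tau n * D n.
Proof. by rewrite normrM ger0_norm // ler_wpM2l. Qed.

Let tauD0 n : 0 <= tau n * D n.
Proof. by apply: le_trans (y_le (v n)); rewrite normr_ge0. Qed.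

(** As the [delta] sum to 0, leaving out [v n] leaves minus its own term. *)
Let p0_le n : `|p n 0| <= tau n * D n.
Proof.
suff -> : p n 0 = - (tau n * @delta n (v n)) by rewrite normrN.
apply/eqP; rewrite -addr_eq0 -(expr1 (_ * _)) addrC.
rewrite -(big_setU1 (v n) (A := [set~ v n]%SET)) /=; last by rewrite !inE eqxx.
rewrite finset.setUCr; under eq_bigr do rewrite expr1.
by rewrite -mulr_sumr (eq_bigl xpredT) ?sum_delta ?mulr0 // => i; rewrite inE.
Qed.

Let p1E n : p n 1 = S n - (tau n * @delta n (v n)) ^+ 2.
Proof.
rewrite /S mulr_sumr (bigD1 (v n)) //= exprMn [RHS]addrC addKr /p.
by apply: eq_big => i; rewrite ?exprMn // !inE.
Qed.

(** Of the [i + 2] factors, [i] are bounded by [tau n * D n]; the other two form a sum of squares,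
    which only grows when [v n] is put back. *)
Let p_le n i : `|p n i.+1| <= (tau n * D n) ^+ i * S n.
Proof.
apply: le_trans (ler_norm_sum _ _ _) _; rewrite /S mulr_sumr mulr_sumr.
apply: (@le_trans _ _ (\sum_(w in [set~ v n]%SET)
    (tau n * D n) ^+ i * (tau n ^+ 2 * @delta n w ^+ 2))).
  apply: ler_sum => w _; rewrite -addn2 exprD normrM -exprMn ler_pM //.
    by rewrite normrX lerXn2r ?nnegrE.
  by rewrite ger0_norm // sqr_ge0.
rewrite [leRHS](bigID [in [set~ v n]%SET]) /= lerDl sumr_ge0 // => w _.
by rewrite mulr_ge0 ?exprn_ge0 // -exprMn sqr_ge0.
Qed.

Lemma power_sum_cvg i : p n i @[n --> \oo] --> (if i == 1 then x ^+ 2 else 0).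
Proof.
have to0 (f g : nat -> R) : (forall n, `|f n| <= g n) -> g @ \oo --> (0 : R) ->
    f @ \oo --> (0 : R).
  move=> fg g0; apply: norm_cvg0; apply: (@squeeze_cvgr _ _ _ _ (fun=> 0) g) => //.
    by near=> n; rewrite normr_ge0 fg.
  exact: cvg_cst.
case: i => [|[|i]] /=.
- exact: to0 p0_le tauD.
- under eq_fun do rewrite p1E.
  apply: (cvgB_to S_cvg _ (subr0 _)).
  apply: (to0 _ (fun n => tau n * D n * (tau n * D n))).
    by move=> n; rewrite normrX expr2 ler_pM.
  exact: cvgM_to tauD tauD (mulr0 0).
- apply: (to0 _ _ (fun n => p_le n i.+1)).
  apply: (cvgM_to _ S_cvg (mul0r _)).
  under eq_fun do rewrite exprS.
  apply: (cvgM_to tauD _ (mul0r (0 ^+ i))).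
  by elim: i => [|i IH]; under eq_fun do rewrite ?exprS ?expr0;
    rewrite ?exprS ?expr0; [exact: cvg_cst|exact: cvgM_to tauD IH _].
Unshelve. all: by end_near. Qed.

Lemma power_sum_bound :
  \forall n \near \oo, forall i, `|p n i| <= 4 * (x ^+ 2 + 1) / 4 ^+ i.
Proof.
near=> n.
(* The threshold 1/4 yields the geometric ratio that [newton_bound] asks for; the factor 4 in the
   constant absorbs the index shift in [p_le]. *)
have tn : tau n * D n <= 4^-1.
  by apply/ltW; near: n; apply: (cvgr_lt _ tauD); rewrite invr_gt0.
have Sn : S n <= x ^+ 2 + 1.
  by apply/ltW; near: n; apply: (cvgr_lt _ S_cvg); rewrite ltrDl.
have x2 := sqr_ge0 x.
case=> [|i].
  by apply: le_trans (p0_le n) _; rewrite expr0 divr1; lra.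
apply: le_trans (p_le n i) _.
have -> : 4 * (x ^+ 2 + 1) / 4 ^+ i.+1 = 4^-1 ^+ i * (x ^+ 2 + 1).
  have : 4 ^+ i != 0 :> R by rewrite expf_neq0.
  by rewrite exprVn (exprS 4); set y := 4 ^+ i => y0; field; rewrite y0.
apply: ler_pM => //; first by rewrite exprn_ge0.
  by rewrite mulr_ge0 ?sqr_ge0 ?sumr_ge0 // => w _; rewrite sqr_ge0.
by rewrite lerXn2r ?nnegrE ?invr_ge0.
Unshelve. all: by end_near. Qed.
End Sequences.

Lemma elsym_ratio_cvg (delta : forall n, 'I_n.+1 -> R) (v : forall n, 'I_n.+1)
  (k : nat -> nat) (D : nat -> R) (x : R) (tau := fun n => (k n)%:R / n%:R) :
  (forall n, \sum_i delta n i = 0) -> (forall n i, `|delta n i| <= D n) ->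
  k n @[n --> \oo] --> \oo -> tau @ \oo --> (0 : R) ->
  (tau n * D n) @[n --> \oo] --> (0 : R) ->
  (tau n ^+ 2 * \sum_i delta n i ^+ 2) @[n --> \oo] --> x ^+ 2 ->
  (elsym (fun i => 1 + delta n i) [set~ v n]%SET (k n) / 'C(n.+1, k n)%:R)
     @[n --> \oo] --> expR (- x ^+ 2 / 2).
Proof.
move=> sd dD koo t0 tD tS.
have tau_ge0 n : 0 <= tau n by rewrite divr_ge0.
have kn : \forall n \near \oo, (0 < k n <= n)%N.
  near=> n; apply/andP; split; first by near: n; move/cvgnyPgt : koo; apply.
  have n0 : (0 < n)%N by near: n; exact: nbhs_infty_ge.
  have : tau n < 1 by near: n; apply: (cvgr_lt _ t0).
  by rewrite ltr_pdivrMr ?ltr0n // mul1r ltr_nat => /ltnW.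
pose rhs n := (1 - (k n)%:R / n.+1%:R) * \sum_(0 <= j < (k n).+1)
  elsym (fun i => tau n * delta n i) [set~ v n]%SET j * ffact_ratio R (k n) n j.
apply: (@cvg_trans _ (rhs @ \oo)).
  apply: near_eq_cvg; near=> n; rewrite elsym_1D_ratio //.
  by near: n.
(* The prefactor tends to 1, since it differs from 1 by at most [tau n]. *)
apply: (cvgM_to _ _ (mul1r _)).
  apply: (cvgB_to _ _ (subr0 1)); first exact: cvg_cst.
  apply: (@squeeze_cvgr _ _ _ _ (fun=> 0) tau) => //; last exact: cvg_cst.
  near=> n; rewrite divr_ge0 //= ler_wpM2l // lef_pV2 ?posrE ?ltr0n ?ler_nat //.
  by near: n; exact: nbhs_infty_ge.
apply: (newton_sum_cvg _ _ (power_sum_bound v tau_ge0 sd dD tD tS) koo).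
- by move=> n; apply: newton_rec_elsym.
- exact: power_sum_cvg.
- by near=> n; have /andP[] : (0 < k n <= n)%N by near: n.
Unshelve. all: by end_near. Qed.
End Elsym.

(** * Degree sequences at the scale x sqrt(n / sigma^2) *)

Section RayleighLimit.
Local Open Scope classical_set_scope.
Local Open Scope ring_scope.
Variable R : realType.
Variables (d : forall n : nat, 'I_n.+1 -> nat) (v : forall n : nat, 'I_n.+1) (x : R).
Let delta n (i : 'I_n.+1) : R := (@d n i)%:R - 1.
Let s n := (\sum_i @delta n i ^+ 2) / n.+1%:R.
Let w n := Num.sqrt (n.+1%:R * s n).
Let t n := x * Num.sqrt (n.+1%:R / s n).
Let k n := Num.truncn (t n).

Hypothesis x0 : 0 < x.
Hypothesis sum_d : forall n : nat, (\sum_(i < n.+1) @d n i = n.+1)%N.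
Hypothesis s_small : forall eps, 0 < eps -> \forall n \near \oo, s n <= eps * n.+1%:R.
Hypothesis s_large : forall eps, 0 < eps -> \forall n \near \oo, n.+1%:R^-1 <= eps * s n.
Hypothesis maxdeg_small : forall eps, 0 < eps ->
  \forall n \near \oo, (maxdeg (@d n))%:R <= eps * w n.

Let sE n : n.+1%:R * s n = \sum_i @delta n i ^+ 2.
Proof. by rewrite mulrC divfK // pnatr_eq0. Qed.

Let s_ge0 n : 0 <= s n.
Proof. by rewrite divr_ge0 // sumr_ge0 // => i _; rewrite sqr_ge0. Qed.

Let s_gt0 : \forall n \near \oo, 0 < s n.
Proof.
near=> n; rewrite -(mul1r (s n)); apply: (@lt_le_trans _ _ n.+1%:R^-1).
  by rewrite invr_gt0 ltr0n.
by near: n; exact: s_large.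
Unshelve. all: by end_near. Qed.

Let t_ge0 n : 0 <= t n.
Proof. by rewrite mulr_ge0 ?sqrtr_ge0 // ltW. Qed.

(** The hypothesis expresses divergence of [f] in the form that a little-o assumption delivers. The
    proof compares with [|A| + 1] because a positive bound can be squared. *)
Let sqrt_near_ge (f : nat -> R) A : (forall eps, 0 < eps -> \forall n \near \oo, 1 <= eps * f n) ->
  \forall n \near \oo, A <= Num.sqrt (f n).
Proof.
move=> hf; have A1 : 0 < `|A| + 1 by rewrite ltr_wpDl.
near=> n; apply: (@le_trans _ _ (`|A| + 1)).
  by apply: le_trans (ler_norm A) _; rewrite lerDl.
rewrite -[leLHS](gtr0_norm A1) -sqrtr_sqr ler_wsqrtr //.
have : 1 <= ((`|A| + 1) ^+ 2)^-1 * f n.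
  by near: n; apply: hf; rewrite invr_gt0 exprn_gt0.
by rewrite mulrC ler_pdivlMr ?exprn_gt0 // mul1r.
Unshelve. all: by end_near. Qed.

(** Here sigma^2 = omega(1/n) enters, giving n sigma^2 -> oo. *)
Let w_cvg : w @ \oo --> +oo.
Proof.
apply/cvgryPge => A; apply: sqrt_near_ge => eps e0; near=> n.
have : n.+1%:R^-1 <= eps * s n by near: n; exact: s_large.
by move=> /(ler_wpM2l (ler0n R n.+1)); rewrite divff ?pnatr_eq0 // mulrCA.
Unshelve. all: by end_near. Qed.

(** Here sigma^2 = o(n) enters: the number of steps tends to infinity. *)
Let t_cvg : t @ \oo --> +oo.
Proof.
apply/cvgryPge => A; near=> n; rewrite /t mulrC -ler_pdivrMr //.
near: n; apply: sqrt_near_ge => eps e0; near=> n.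
have sn : 0 < s n by near: n.
have : s n <= eps * n.+1%:R by near: n; exact: s_small.
by rewrite mulrA ler_pdivlMr ?mul1r.
Unshelve. all: by end_near. Qed.

Let k_cvg : k n @[n --> \oo] --> \oo.
Proof.
apply/cvgnyPge => A; near=> n; rewrite truncn_ge_nat //.
by near: n; move/cvgryPge: t_cvg; apply.
Unshelve. all: by end_near. Qed.

Let inv_cvg (f : nat -> R) : f @ \oo --> +oo -> (f n)^-1 @[n --> \oo] --> (0 : R).
Proof.
move=> foo; apply/gtr0_cvgV0 => //.
by move/cvgryPgt: foo; apply.
Qed.

Let kt_cvg : ((k n)%:R / t n) @[n --> \oo] --> (1 : R).
Proof.
apply: (@squeeze_cvgr _ _ _ _ (fun n => 1 - (t n)^-1) (fun=> 1)).
- near=> n; have tn : 0 < t n by near: n; move/cvgryPgt: t_cvg; apply.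
  have /andP[kt tk] := truncn_itv (t_ge0 n).
  rewrite ler_pdivrMr // mul1r kt andbT ler_pdivlMr // mulrBl mulVf ?gt_eqF // mul1r.
  by rewrite lerBlDr natr1 ltW.
- by apply: (cvgB_to _ (inv_cvg t_cvg) (subr0 1)); exact: cvg_cst.
- exact: cvg_cst.
Unshelve. all: by end_near. Qed.

Let tw n : 0 < s n -> t n * w n = x * n.+1%:R.
Proof.
move=> sn; have r0 : 0 <= n.+1%:R / s n by apply: divr_ge0.
rewrite /t /w -mulrA -sqrtrM // mulrACA mulVf ?gt_eqF //.
by rewrite mulr1 -expr2 sqrtr_sqr ger0_norm.
Qed.

Let nn_cvg : (n.+1%:R / n%:R) @[n --> \oo] --> (1 : R).
Proof.
apply: (@cvg_trans _ ((1 + n%:R^-1 : R) @[n --> \oo])).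
  apply: near_eq_cvg; near=> n.
  have n0 : n%:R != 0 :> R by rewrite pnatr_eq0 -lt0n; near: n; exact: nbhs_infty_ge.
  by rewrite -[in RHS]natr1 mulrDl divff // mul1r.
apply: (cvgD_to _ _ (addr0 1)); first exact: cvg_cst.
apply: inv_cvg; exact: cvgr_idn.
Unshelve. all: by end_near. Qed.

(** The denominator counts the vertices other than [v n], whereas [t] and [w] are scaled by [n.+1];
    [nn_cvg] reconciles the two. *)
Let tau n : R := (k n)%:R / n%:R.

(** By [tw], [tau n] behaves like [x / w n]. As [w n ^+ 2] is the sum of the squared [delta], the
    second power sum of [tau n * delta] tends to [x ^+ 2]. *)
Let tauw_cvg : (tau n * w n) @[n --> \oo] --> x.
Proof.
apply: (@cvg_trans _ (((k n)%:R / t n * (x * (n.+1%:R / n%:R)) : R) @[n --> \oo])).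
  apply: near_eq_cvg; near=> n.
  have tn : t n != 0 by rewrite gt_eqF //; near: n; move/cvgryPgt: t_cvg; apply.
  have sn : 0 < s n by near: n.
  have n0 : n%:R != 0 :> R by rewrite pnatr_eq0 -lt0n; near: n; exact: nbhs_infty_ge.
  by rewrite (mulrA x) -tw // /tau; field; rewrite n0 tn.
apply: (cvgM_to kt_cvg _ (mul1r x)).
by apply: (cvgM_to _ nn_cvg (mulr1 x)); exact: cvg_cst.
Unshelve. all: by end_near. Qed.

Let w_gt0 : \forall n \near \oo, 0 < w n.
Proof. by move/cvgryPgt: w_cvg; apply. Qed.

Let tau_cvg : tau @ \oo --> (0 : R).
Proof.
apply: (@cvg_trans _ ((tau n * w n * (w n)^-1) @[n --> \oo])).
  apply: near_eq_cvg; near=> n.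
  by rewrite mulfK // gt_eqF //; near: n.
exact: cvgM_to tauw_cvg (inv_cvg w_cvg) (mulr0 x).
Unshelve. all: by end_near. Qed.

Let delta_le n (i : 'I_n.+1) : `|delta i| <= (maxdeg (@d n))%:R + 1.
Proof.
apply: le_trans (ler_normB _ _) _; rewrite normr1 ger0_norm // lerD2r ler_nat.
exact: (leq_bigmax (F := @d n)).
Qed.

(** The maximal degree is o([w]) and [tau] is of order [1 / w]; the extra 1, which comes from
    centring the degrees, is handled by [tau_cvg]. *)
Let tauD_cvg : (tau n * ((maxdeg (@d n))%:R + 1)) @[n --> \oo] --> (0 : R).
Proof.
have Dw : ((maxdeg (@d n))%:R / w n) @[n --> \oo] --> (0 : R).
  apply/cvgr0Pnorm_le => eps e0; near=> n.
  have wn : 0 < w n by near: n.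
  rewrite ger0_norm ?divr_ge0 ?(ltW wn) // ler_pdivrMr //.
  by near: n; exact: maxdeg_small.
apply: (@cvg_trans _ ((tau n * w n * ((maxdeg (@d n))%:R / w n) + tau n) @[n --> \oo])).
  apply: near_eq_cvg; near=> n.
  have wn : w n != 0 by rewrite gt_eqF //; near: n.
  by field.
apply: (cvgD_to _ tau_cvg (addr0 0)).
exact: cvgM_to tauw_cvg Dw (mulr0 x).
Unshelve. all: by end_near. Qed.

Lemma elsym_rayleigh_cvg :
  (elsym (fun i => (@d n i)%:R) [set~ v n]%SET (k n) / 'C(n.+1, k n)%:R)
    @[n --> \oo] --> expR (- x ^+ 2 / 2).
Proof.
apply: (@cvg_trans _ ((elsym (fun i => 1 + delta i) [set~ v n]%SET (k n) /
    'C(n.+1, k n)%:R) @[n --> \oo])).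
  apply: near_eq_cvg; near=> n; congr (_ / _).
  apply: eq_bigr => S _; apply: eq_bigr => i _.
  by rewrite /delta addrC subrK.
apply: (@elsym_ratio_cvg R delta v k (fun n => (maxdeg (@d n))%:R + 1) x) => //.
- move=> n; rewrite sumrB sumr_const card_ord -natr_sum sum_d.
  by rewrite subrr.
- apply: (@cvg_trans _ ((tau n * w n) ^+ 2 @[n --> \oo])).
    apply: near_eq_cvg; near=> n.
    by rewrite exprMn sqr_sqrtr ?sE // -sE; apply: mulr_ge0.
  by apply: (cvgM_to tauw_cvg tauw_cvg).
Unshelve. all: by end_near. Qed.

(** Supplies the bound under which [prob_six_gtE] applies. *)
Lemma rayleigh_index_leq : \forall n \near \oo, (k n <= n.+1)%N.
Proof.
near=> n.
have n0 : (0 < n)%N by near: n; exact: nbhs_infty_ge.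
have : tau n < 1 by near: n; apply: (cvgr_lt _ tau_cvg).
by rewrite ltr_pdivrMr ?ltr0n // mul1r ltr_nat => /ltnW /leqW.
Unshelve. all: by end_near. Qed.
End RayleighLimit.

(** * Transfer to the reals of the standard library *)

Section StdlibReals.
Local Open Scope classical_set_scope.
Local Open Scope ring_scope.

Lemma little_o_near (a b : nat -> R) eps : little_o a b -> 0 < eps ->
  \forall n \near \oo, `|a n| <= eps * `|b n|.
Proof.
move=> h /RltP /h[N hN]; exists N => // n /= /ssrnat.leP /hN.
by rewrite !RabsE => /RleP.
Qed.

(** When the squares are expanded, the degree sum turns [- 2 * \sum_i d i + n.+1] into [- n.+1]. *)
Lemma sigma2E n (d : 'I_n.+1 -> nat) : \sum_(i < n.+1) d i = n.+1 ->
  n.+1%:R * sigma2 d = \sum_i ((d i)%:R - 1) ^+ 2.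
Proof.
move=> hs; rewrite /sigma2 !INRE RdivE RminusE R1E.
rewrite mulrBr mulr1 mulrCA mulfV ?pnatr_eq0 // mulr1.
under [RHS]eq_bigr => i _ do rewrite sqrrB1.
rewrite big_split sumrB /= sumrMnl sumr_const card_ord -natr_sum hs /m2 natr_sum.
under eq_bigr do rewrite PeanoNat.Nat.pow_2_r natrM -expr2.
by rewrite mulr2n; ring.
Qed.

(** The six-length is an integer, so exceeding [t] means exceeding its integer part [k]. The count
    is then [card_fresh_walks] with no earlier vertices, where [k!] cancels against the falling
    factorial. *)
Lemma prob_six_gtE n (d : 'I_n.+1 -> nat) (v : 'I_n.+1) (t : R) :
  \sum_(i < n.+1) d i = n.+1 -> 0 <= t -> (Num.truncn t <= n.+1)%N ->
  prob_six_gt d v t =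
  elsym (fun i => (d i)%:R) [set~ v]%SET (Num.truncn t) / 'C(n.+1, Num.truncn t)%:R.
Proof.
move=> hs t0; set k := Num.truncn t => kn; rewrite /prob_six_gt !INRE RdivE.
have -> : #|[set f in fgraphs d | if Rlt_dec t (INR (sixlen f v)) then true else false]%SET| =
    #|fresh_walks d k v [::]|.
  apply: eq_card => f; rewrite !inE [path _ _ _]/= andbT -ltn_sixlen ?card_ord //; congr andb.
  rewrite /k truncn_lt_nat // -INRE.
  by case: Rlt_dec => H; apply/esym; [apply/RltP|apply/negbTE/RltP].
have Fw : #|walks d v [::]| = #|fgraphs d|.
  by apply: eq_card => f; rewrite [LHS]inE andbT.
have F0 : #|fgraphs d|%:R != 0 :> R by rewrite pnatr_eq0 -lt0n fgraphs_neq0.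
have B0 : 'C(n.+1, k)%:R != 0 :> R by rewrite pnatr_eq0 -lt0n bin_gt0.
have k0 : k`!%:R != 0 :> R by rewrite pnatr_eq0 -lt0n fact_gt0.
have := @card_fresh_walks _ d R k v [::] isT.
rewrite subn0 -bin_ffact Fw mulnA natrM -[RHS]mulr_natr => /(mulIf k0).
rewrite natrM (_ : (~: [set:: [:: v]])%SET = [set~ v]%SET); last first.
  by apply/setP => i; rewrite !inE.
by move=> E; apply/eqP; rewrite eqr_div // E mulrC.
Qed.

Lemma prob_six_gt_Un_cv (d : forall n : nat, 'I_n.+1 -> nat)
    (v : forall n : nat, 'I_n.+1) (x : R) :
  (forall n, (\sum_(i < n.+1) d n i)%N = n.+1) ->
  little_o (fun n => sigma2 (d n)) (fun n => INR n.+1) ->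
  little_o (fun n => Rinv (INR n.+1)) (fun n => sigma2 (d n)) ->
  little_o (fun n => INR (maxdeg (d n))) (fun n => sqrt (Rmult (INR n.+1) (sigma2 (d n)))) ->
  0 < x ->
  Un_cv (fun n => prob_six_gt (d n) (v n) (Rmult x (sqrt (Rdiv (INR n.+1) (sigma2 (d n))))))
    (Rtrigo_def.exp (Rdiv (Ropp (pow x 2)) (IZR 2))).
Proof.
move=> hsum h1 h2 h3 x0.
pose s n : R := (\sum_i ((d n i)%:R - 1) ^+ 2) / n.+1%:R.
have sE n : sigma2 (d n) = s n.
  by rewrite /s -sigma2E // mulrC mulKf // pnatr_eq0.
(* Nonnegativity removes the absolute values that [little_o] puts around both sequences. *)
have s_ge0 n : 0 <= s n.
  by apply: divr_ge0 => //; apply: sumr_ge0 => i _; apply: sqr_ge0.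
have s_small eps : 0 < eps -> \forall n \near \oo, s n <= eps * n.+1%:R.
  move=> /(little_o_near h1)[N _ hN]; exists N => // n /hN; cbv beta.
  by rewrite sE INRE !ger0_norm.
have s_large eps : 0 < eps -> \forall n \near \oo, n.+1%:R^-1 <= eps * s n.
  move=> /(little_o_near h2)[N _ hN]; exists N => // n /hN; cbv beta.
  by rewrite sE RinvE INRE !ger0_norm // invr_ge0.
have D_small eps : 0 < eps -> \forall n \near \oo,
    (maxdeg (d n))%:R <= eps * Num.sqrt (n.+1%:R * s n).
  move=> /(little_o_near h3)[N _ hN]; exists N => // n /hN; cbv beta.
  by rewrite sE RmultE RsqrtE !INRE !ger0_norm ?sqrtr_ge0.
have [N1 _ hN1] := @rayleigh_index_leq R d x x0 s_small s_large.
move=> eps /RltP e0.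
have [N2 hN2] := cvg_dist_lt (@elsym_rayleigh_cvg R d v x x0 hsum s_small s_large D_small) e0.
exists (maxn N1 N2) => n /ssrnat.leP; rewrite geq_max => /andP[n1 n2].
apply/RltP; rewrite RexpE [in Rdist _ _]RdivE RoppE RpowE RdistE distrC.
rewrite RmultE RsqrtE RdivE INRE sE prob_six_gtE //.
- exact: hN2.
- by apply: mulr_ge0; [exact: ltW|exact: sqrtr_ge0].
- exact: hN1.
Qed.

End StdlibReals.

Unset Implicit Arguments.
Delimit Scope R_scope with R.

(* The family is indexed by n : nat, the n-th member living on [n.+1]
   (i.e. N = n+1 ranges over N >= 1). *)
Theorem theorem2p1
  (d : forall n : nat, 'I_n.+1 -> nat)
  (v : forall n : nat, 'I_n.+1)
  (hsum : forall n : nat, \sum_(i < n.+1) d n i = n.+1)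
  (h1 : little_o (fun n => sigma2 (d n)) (fun n => INR n.+1))
  (h2 : little_o (fun n => (/ INR n.+1)%R) (fun n => sigma2 (d n)))
  (h3 : little_o (fun n => INR (maxdeg (d n)))
                 (fun n => sqrt (INR n.+1 * sigma2 (d n))%R)) :
  forall x : R, (0 < x)%R ->
    Un_cv (fun n => prob_six_gt (d n) (v n)
                      (x * sqrt (INR n.+1 / sigma2 (d n)))%R)
          (exp (- (x ^ 2) / 2)).
Proof. by move=> x /RltP x0; apply: prob_six_gt_Un_cv. Qed.
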